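(* For any pre-Hilbert spaces $X_0$ and $X_1$, the orthogonal direct sum $X_0\oplus X_1$ is pathological if and only if at least one of $X_0$ and $X_1$ is pathological.
   Context: The scalar field $K$ is $\mathbb{R}$ or $\mathbb{C}$. A pre-Hilbert space is an inner product space over $K$ which need not be complete. An orthonormal basis is an orthonormal subset whose linear span is dense; a pre-Hilbert space is pathological if it has no orthonormal basis. The orthogonal direct sum $X_0\oplus X_1$ is the vector space $\{\langle\mathbf{x},\mathbf{y}\rangle:\mathbf{x}\in X_0,\mathbf{y}\in X_1\}$ with inner product $(\langle\mathbf{x}_0,\mathbf{y}_0\rangle,\langle\mathbf{x}_1,\mathbf{y}_1\rangle)=(\mathbf{x}_0,\mathbf{x}_1)+(\mathbf{y}_0,\mathbf{y}_1)$. *)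

(* Defs.v *)
From HB Require Import structures.
From mathcomp Require Import all_boot all_order all_algebra.
From mathcomp Require Import sesquilinear complex.
From mathcomp Require Import boolp classical_sets reals.

Set Implicit Arguments.
Unset Strict Implicit.
Unset Printing Implicit Defensive.

Import Order.TTheory GRing.Theory Num.Theory.
Local Open Scope ring_scope.

Variant scalar_kind := RealScalars | ComplexScalars.

Definition scalars (R : realType) (k : scalar_kind) : numFieldType :=
  match k with
  | RealScalars => R
  | ComplexScalars => R[i]
  end.

Definition conjK (R : realType) (k : scalar_kind) :
    {rmorphism scalars R k -> scalars R k} :=
  match k return {rmorphism scalars R k -> scalars R k} with
  | RealScalars => idfun
  | ComplexScalars => @Num.conj R[i]
  end.

Definition reK (R : realType) (k : scalar_kind) : scalars R k -> R :=
  match k return scalars R k -> R with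
  | RealScalars => id
  | ComplexScalars => @complex.Re R
  end.

(* The inner product is linear in its first argument and conjugate-linear in
   its second one; positive definiteness is part of {dot _ for _}, where for
   complex scalars [0 < z] means that z is a positive real. *)
Record preHilbert (R : realType) (k : scalar_kind) := PreHilbert {
  carrier :> lmodType (scalars R k);
  inner : {dot carrier for conjK R k}
}.

Section PreHilbert.
Variables (R : realType) (k : scalar_kind) (X : preHilbert R k).
Local Open Scope classical_set_scope.
Implicit Types (x y : X) (B : set X).

(* [inner x x] is a nonnegative real, so taking its real part loses nothing. *)
Definition hnorm x : R := Num.sqrt (reK (inner X x x)).

Definition orthonormal_set B :=
  (forall x, B x -> inner X x x = 1) /\
  (forall x y, B x -> B y -> x <> y -> inner X x y = 0).

Definition linear_span B : set X :=
  [set x | exists (n : nat) (c : 'I_n -> scalars R k) (v : 'I_n -> X),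
      (forall i, B (v i)) /\ x = \sum_i c i *: v i].

Definition norm_dense (A : set X) :=
  forall x (e : R), 0 < e -> exists2 y, A y & hnorm (x - y) < e.

Definition orthonormal_basis B :=
  orthonormal_set B /\ norm_dense (linear_span B).

Definition pathological := ~ exists B : set X, orthonormal_basis B.

End PreHilbert.

Section DirectSum.
Variables (R : realType) (k : scalar_kind) (X0 X1 : preHilbert R k).

Definition dsum_inner (u v : X0 * X1) : scalars R k :=
  inner X0 u.1 v.1 + inner X1 u.2 v.2.

Let dsum_bilinear :
  bilinear_for (GRing.Scale.Law.clone _ _ *%R _)
    (GRing.Scale.Law.clone _ _ (conjK R k \; *%R) _) dsum_inner.
Proof.
split=> w a u v; rewrite /dsum_inner /=.
- by rewrite !linearPl mulrDr addrACA.
- by rewrite !linearPr /= mulrDr addrACA.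
Qed.

HB.instance Definition _ :=
  bilinear_isBilinear.Build (scalars R k) (X0 * X1)%type (X0 * X1)%type
    (scalars R k) _ _ dsum_inner dsum_bilinear.

Let dsum_hermitian u v :
  dsum_inner u v = (-1) ^+ false * conjK R k (dsum_inner v u).
Proof.
rewrite /dsum_inner rmorphD mulrDr.
by congr (_ + _); apply: hermitian_subproof.
Qed.

HB.instance Definition _ :=
  isHermitianSesquilinear.Build (scalars R k) (X0 * X1)%type false (conjK R k)
    dsum_inner dsum_hermitian.

Let dsum_pos u : u != 0 -> 0 < dsum_inner u u.
Proof.
have ge0 (X : preHilbert R k) (x : X) : 0 <= inner X x x.
  by have [->|/neq0_dnorm_gt0/ltW//] := eqVneq x 0; rewrite linear0l.
case: u => x y; rewrite /dsum_inner /= -pair_eqE /pair_eq negb_and.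
case/orP=> [x0|y0].
- exact: ltr_wpDr (ge0 _ _) (neq0_dnorm_gt0 _ x0).
- exact: ltr_wpDl (ge0 _ _) (neq0_dnorm_gt0 _ y0).
Qed.

HB.instance Definition _ :=
  isDotProduct.Build (scalars R k) (X0 * X1)%type dsum_inner dsum_pos.

Definition dsum : preHilbert R k :=
  @PreHilbert R k (X0 * X1)%type dsum_inner.

End DirectSum.

(* Main.v *)
(** The nontrivial point is that an orthonormal basis [B] of [X0 (+) X1] yields
one of [X0]. Let [p] be the orthogonal projection onto [X0]. For [b] in [B],
[p b] lies in the closed span of [B], so [(p b, p b') = (p b, b')] is nonzero
for only countably many [b'] in [B]. Hence the non-orthogonality graph on
[p @` B] has countable connected components; distinct components are orthogonal,
and Gram-Schmidt applied to an enumeration of each component produces an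
orthonormal set whose span contains [p @` B], which is dense in [X0] because [p]
is a contraction. *)

Require Import Defs.
From mathcomp Require Import all_boot all_order all_algebra.
From mathcomp Require Import sesquilinear complex.
From mathcomp Require Import boolp classical_sets cardinality reals.
From Stdlib Require Import Relation_Operators Operators_Properties.

Set Implicit Arguments.
Unset Strict Implicit.
Unset Printing Implicit Defensive.

Import Order.TTheory GRing.Theory Num.Theory.
Local Open Scope ring_scope.
Local Open Scope classical_set_scope.

(** * Order and conjugation, uniformly for real and complex scalars *)

Section Scalars.
Variables (R : realType) (k : scalar_kind).
Implicit Types c z w : scalars R k.

Lemma mul_conjK_ge0 c : 0 <= c * conjK R k c.
Proof. by case: k c => c /=; [rewrite -expr2 sqr_ge0 | exact: mul_conjC_ge0]. Qed.

Lemma mul_conjK_eq0 c : c * conjK R k c = 0 -> c = 0.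
Proof. by move=> /eqP; rewrite mulf_eq0 fmorph_eq0 orbb => /eqP. Qed.

Lemma reKD z w : reK (z + w) = reK z + reK w.
Proof. by case: k z w => // -[a b] [c d]. Qed.

Lemma ler_reK z w : z <= w -> reK z <= reK w.
Proof. by case: k z w => //= -[a b] [c d]; rewrite lecE /= => /andP[]. Qed.

Lemma reK_ge0 z : 0 <= z -> 0 <= reK z.
Proof. by move/ler_reK; case: k z. Qed.

(** Over the complex numbers, [0 <= z] already forces the imaginary part to vanish. *)
Lemma reK_eq0 z : 0 <= z -> reK z = 0 -> z = 0.
Proof.
case: k z => //= -[a b]; rewrite lecE /= => /andP[/eqP-> _] ->.
by [].
Qed.

(** The inverse square root of [z] is real, hence fixed by conjugation. With [z = (x, x)] the left
    side is [(a x, a x)], so [a] normalizes [x]. *)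
Lemma normalizing_scalar z : 0 < z -> exists a, a * (conjK R k a * z) = 1.
Proof.
case: k z => /= z z0.
  exists (Num.sqrt z)^-1; rewrite mulrA -invfM -expr2 sqr_sqrtr ?ltW//.
  by rewrite mulVf// gt_eqF.
have s0 : 0 <= sqrtC z by rewrite sqrtC_ge0 ltW.
exists (sqrtC z)^-1; rewrite fmorphV /= geC0_conj // mulrA -invfM -expr2 sqrtCK.
by rewrite mulVf// gt_eqF.
Qed.

End Scalars.

(** * Closure properties of linear spans *)

Section Span.
Variables (R : realType) (k : scalar_kind) (X : preHilbert R k).
Implicit Types (x y z : X) (A B : set X).

Lemma linear_span0 B : linear_span B 0.
Proof.
exists 0%N, (fun=> 0), (fun=> 0); split=> [[]//|].
by rewrite big_ord0.
Qed.

Lemma linear_spanP B a x y :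
  linear_span B x -> linear_span B y -> linear_span B (a *: x + y).
Proof.
move=> [n [c [u [Bu ->]]]] [m [d [v [Bv ->]]]].
exists (n + m)%N, (fun i => match fintype.split i with inl j => a * c j | inr j => d j end),
  (fun i => match fintype.split i with inl j => u j | inr j => v j end).
split=> [i|]; first by case: (fintype.split i).
rewrite big_split_ord /= scaler_sumr; congr (_ + _); apply: eq_bigr => i _.
  by rewrite -[lshift _ _]/(unsplit (inl i)) unsplitK scalerA.
by rewrite -[rshift _ _]/(unsplit (inr i)) unsplitK.
Qed.

Lemma sub_linear_span B : B `<=` linear_span B.
Proof.
move=> x Bx; exists 1%N, (fun=> 1), (fun=> x); split=> //.
by rewrite big_ord_recl big_ord0 scale1r addr0.
Qed.

Lemma linear_spanZ B a x : linear_span B x -> linear_span B (a *: x).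
Proof. by move=> /(@linear_spanP B a)/(_ (linear_span0 B)); rewrite addr0. Qed.

Lemma linear_spanD B x y :
  linear_span B x -> linear_span B y -> linear_span B (x + y).
Proof. by move=> /(@linear_spanP B 1) h /h; rewrite scale1r. Qed.

Lemma linear_span_sum B n (F : 'I_n -> X) :
  (forall i, linear_span B (F i)) -> linear_span B (\sum_i F i).
Proof.
move=> BF; elim/big_ind: _ => //; first exact: linear_span0.
exact: linear_spanD.
Qed.

Lemma linear_span_ind B (P : X -> Prop) :
  P 0 -> (forall a x y, P x -> P y -> P (a *: x + y)) ->
  (forall x, B x -> P x) -> forall x, linear_span B x -> P x.
Proof.
move=> P0 PP PB _ [n [c [v [Bv ->]]]].
elim: n c v Bv => [|n IH] c v Bv; first by rewrite big_ord0.
by rewrite big_ord_recl; apply: PP; [exact: PB | exact: IH].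
Qed.

Lemma linear_span_sub A B : A `<=` linear_span B ->
  linear_span A `<=` linear_span B.
Proof.
move=> AB; apply: linear_span_ind => //; first exact: linear_span0.
by move=> *; exact: linear_spanP.
Qed.

Lemma subset_linear_span A B : A `<=` B -> linear_span A `<=` linear_span B.
Proof. by move=> AB; apply: linear_span_sub => x /AB; exact: sub_linear_span. Qed.

End Span.

Lemma linear_span_image (R : realType) (k : scalar_kind) (X Y : preHilbert R k)
    (f : {linear X -> Y}) (B : set X) (x : X) :
  linear_span B x -> linear_span (f @` B) (f x).
Proof.
apply: (@linear_span_ind _ _ _ _ (fun x => linear_span (f @` B) (f x))).
- by rewrite linear0; exact: linear_span0.
- by move=> a y z; rewrite linearP; exact: linear_spanP.
- by move=> y By; apply: sub_linear_span; exists y.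
Qed.

(** * Inner product estimates and orthonormalization *)

Section Inner.
Variables (R : realType) (k : scalar_kind) (X : preHilbert R k).
Implicit Types (x y z : X) (A B : set X).

Lemma innerC x y : inner X x y = conjK R k (inner X y x).
Proof. by rewrite hermC expr0 mul1r. Qed.

Lemma inner_eq0C x y : inner X x y = 0 -> inner X y x = 0.
Proof. by move=> xy; rewrite innerC xy rmorph0. Qed.

Lemma inner_gt0 x : x != 0 -> 0 < inner X x x.
Proof. exact: neq0_dnorm_gt0. Qed.

Lemma inner_ge0 x : 0 <= inner X x x.
Proof. by have [->|/inner_gt0/ltW//] := eqVneq x 0; rewrite linear0l. Qed.

Lemma ler_hnorm (Y : preHilbert R k) x (y : Y) :
  inner X x x <= inner Y y y -> hnorm x <= hnorm y.
Proof. by move=> /ler_reK xy; rewrite /hnorm ler_wsqrtr. Qed.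

Lemma span_orthogonal A B :
  (forall x y, A x -> B y -> inner X x y = 0) ->
  forall x y, linear_span A x -> linear_span B y -> inner X x y = 0.
Proof.
move=> AB x y Ax By; move: x Ax.
apply: linear_span_ind => [|a x x' xy x'y|x Ax]; first by rewrite linear0l.
  by rewrite linearPl /= xy x'y mulr0 addr0.
move: y By; apply: linear_span_ind => [|a y y' xy xy'|y By]; last exact: AB.
  by rewrite linear0r.
by rewrite linearPr /= xy xy' mulr0 addr0.
Qed.

(** Bessel's inequality for one vector: the gap is the squared norm of [x] minus its projection onto
    [b]. *)
Lemma inner_unit_le x b : inner X b b = 1 ->
  inner X x b * conjK R k (inner X x b) <= inner X x x.
Proof.
move=> b1; set c := inner X x b; rewrite -subr_ge0.
suff -> : inner X x x - c * conjK R k c = inner X (x - c *: b) (x - c *: b).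
  exact: inner_ge0.
rewrite linearBl !linearBr /= !linearZl_LR !linearZr_LR /= b1 -/c (innerC b x) -/c.
by rewrite mulr1 [conjK R k c * c]mulrC subrr subr0.
Qed.

Lemma sqr_hnorm x : hnorm x ^+ 2 = reK (inner X x x).
Proof. by rewrite sqr_sqrtr// reK_ge0// inner_ge0. Qed.

(** Approximate [x] by [y n] in the span of [B], within 1/(n+1). Each [y n] involves finitely many
    basis vectors; any other [b] satisfies [(x, b) = (x - y n, b)]. If [b] occurs in no [y n], this
    is arbitrarily small, hence 0. *)
Lemma orthonormal_inner_countable B x : orthonormal_set B ->
  norm_dense (linear_span B) ->
  countable [set b | B b /\ inner X x b <> 0].
Proof.
move=> [B1 Bo] Bd.
have /choice[y yP] (n : nat) : exists y : X,
    linear_span B y /\ hnorm (x - y) < n.+1%:R^-1.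
  by have [|y] := Bd x n.+1%:R^-1; [rewrite invr_gt0 | exists y].
have /choice[S SP] (n : nat) : exists S : set X, countable S /\
    forall b, B b -> ~ S b -> inner X (y n) b = 0.
  have [[m [c [v [Bv ->]]]] _] := yP n; exists (range v); split.
    exact: sub_countable (card_image_le _ _) (countableP _).
  move=> b Bb vb; rewrite linear_sumlz big1// => i _.
  by rewrite linearZl_LR /= Bo ?mulr0// => vib; apply: vb; exists i.
apply: sub_countable (bigcup_countable (countableP [set: nat]) (fun n _ => (SP n).1)).
apply: subset_card_le => b [Bb xb]; apply: contrapT => bS; apply: xb.
set c := inner X x b; apply: mul_conjK_eq0.
apply: reK_eq0; first exact: mul_conjK_ge0.
have c_small n : reK (c * conjK R k c) < n.+1%:R^-1.
  have -> : c = inner X (x - y n) b.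
    rewrite linearBl /= (SP n).2 ?subr0// => Sb; apply: bS.
    by exists n.
  have /ler_reK/le_lt_trans := inner_unit_le (x - y n) (B1 _ Bb); apply.
  (* The norm of [x - y n] is at most 1, so its square is bounded by the norm itself. *)
  rewrite -sqr_hnorm expr2; have [_ lt_n] := yP n.
  apply: (le_lt_trans _ lt_n); rewrite ler_piMr ?sqrtr_ge0//.
  by rewrite (le_trans (ltW lt_n))// invf_le1 ?ler1n.
apply/eqP; rewrite eq_le reK_ge0 ?mul_conjK_ge0// andbT leNgt.
(* Archimedean contradiction: for [n] the bound of 1/r, both 1/r < n and n+1 < 1/r would hold. *)
apply/negP => c_gt0; set r := reK _ in c_small c_gt0.
have := archi_boundP (ltW (_ : 0 < r^-1)); rewrite invr_gt0 => /(_ c_gt0) lt_r.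
have := c_small (Num.bound r^-1); rewrite -[r]invrK ltf_pV2 ?posrE ?invr_gt0//.
by rewrite invrK => /lt_trans/(_ lt_r); rewrite ltr_nat ltnNge leqnSn.
Qed.

(** The vectors [f n] may be dependent, so some [g n] may be 0; normalization is left for later,
    once these are discarded. *)
Lemma gram_schmidt (f : nat -> X) : exists g : nat -> X,
  (forall n, linear_span (range f) (g n)) /\
  (forall n, linear_span (range g) (f n)) /\
  (forall m n, m <> n -> inner X (g m) (g n) = 0).
Proof.
(* As x / 0 = 0, the projection onto a vanishing vector is 0. *)
pose sub x u := (inner X x u / inner X u u) *: u.
(* Each new vector depends on all earlier ones, so the recursion builds the list of the first [n]
   vectors. *)
pose gs := fix gs n : seq X := if n is m.+1
  then rcons (gs m) (f m - \sum_(u <- gs m) sub (f m) u) else [::].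
pose g n := f n - \sum_(u <- gs n) sub (f n) u.
have gE n : g n = f n - \sum_(i < n) sub (f n) (g i).
  suff gsE : gs n = mkseq g n.
    by rewrite {1}/g gsE big_map -[n in iota 0 n]subn0 big_mkord.
  by elim: n => //= m IH; rewrite mkseqS -IH.
have fE n : f n = \sum_(i < n) sub (f n) (g i) + g n by rewrite gE addrC subrK.
have g_span n : linear_span (range f) (g n).
  elim/ltn_ind: n => n IH; rewrite gE addrC -scaleN1r; apply: linear_spanP.
    by apply: linear_span_sum => i; apply: linear_spanZ; exact: IH.
  by apply: sub_linear_span; exists n.
have g_orth n : forall j, (j < n)%N -> inner X (g n) (g j) = 0.
  elim/ltn_ind: n => n IH j jn.
  rewrite [g n]gE linearBl /= linear_sumlz (bigD1 (Ordinal jn))//= big1.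
    rewrite addr0 linearZl_LR /=.
    have [->|/inner_gt0 gj] := eqVneq (g j) 0; first by rewrite !linear0r mulr0 subr0.
    by rewrite divfK ?subrr// gt_eqF.
  (* The terms with [i] distinct from [j] vanish by induction at the larger of the two indices,
     which is below [n]. *)
  move=> i ij; rewrite linearZl_LR /=.
  have : nat_of_ord i != j := ij.
  rewrite neq_ltn => /orP[lt_ij|lt_ji]; last first.
    by rewrite (IH _ (ltn_ord i) _ lt_ji) mulr0.
  by rewrite (inner_eq0C (IH _ jn _ lt_ij)) mulr0.
exists g; split=> //; split=> [n|m n /eqP].
  rewrite fE; apply: linear_spanD; last by apply: sub_linear_span; exists n.
  apply: linear_span_sum => i; apply: linear_spanZ.
  by apply: sub_linear_span; exists i.
by rewrite neq_ltn => /orP[/g_orth/inner_eq0C//|/g_orth].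
Qed.

Lemma countable_orthonormalization A : countable A -> exists E : set X,
  orthonormal_set E /\ E `<=` linear_span A /\ A `<=` linear_span E.
Proof.
move=> /countable_injP[h h_inj].
pose f n := xget 0 [set x | A x /\ h x = n].
have fA : range f `<=` linear_span A.
  move=> _ [n _ <-]; rewrite /f; case: xgetP => [x _ [Ax _]|_].
    exact: sub_linear_span.
  exact: linear_span0.
have Af : A `<=` range f.
  move=> x Ax; exists (h x) => //; rewrite /f.
  case: xgetP => [y _ [Ay hy]|/(_ x)]; last by case.
  by apply: h_inj; rewrite ?inE.
have [g [g_span [f_span g_orth]]] := gram_schmidt f.
have /choice[a aP] (n : nat) : exists a : scalars R k,
    g n != 0 -> a * (conjK R k a * inner X (g n) (g n)) = 1.
  have [->|/inner_gt0/normalizing_scalar[a aP]] := eqVneq (g n) 0; first by exists 0.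
  by exists a.
exists [set a n *: g n | n in [set n | g n != 0]]; split; [split|split].
- move=> _ [n gn <-]; rewrite linearZl_LR linearZr_LR /=; exact: aP.
- move=> _ _ [m gm <-] [n gn <-] mn.
  rewrite linearZl_LR linearZr_LR /= g_orth ?mulr0// => mn'.
  by apply: mn; rewrite mn'.
- move=> _ [n _ <-]; apply: linear_spanZ; exact: linear_span_sub (g_span n).
- move=> _ /Af[n _ <-]; apply: linear_span_sub (f_span n) => _ [m _ <-].
  have [->|gm] := eqVneq (g m) 0; first exact: linear_span0.
  have am : a m != 0.
    by apply: contra_eq_neq (aP m gm) => ->; rewrite mul0r eq_sym oner_neq0.
  rewrite -(scalerK am (g m)); apply/linear_spanZ/sub_linear_span.
  by exists m.
Qed.

(* The connected components of the non-orthogonality graph on [A] are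
   countable and pairwise orthogonal, so each can be treated separately. *)
Lemma locally_countable_orthonormalization A :
  (forall x, A x -> countable [set y | A y /\ inner X x y <> 0]) ->
  exists E : set X, orthonormal_set E /\ A `<=` linear_span E.
Proof.
move=> Ac; pose r x y := [/\ A x, A y & inner X x y <> 0].
have rC x y : r x y -> r y x.
  by move=> [Ax Ay xy]; split=> // /inner_eq0C.
(* Reflexivity keeps [x] in its component even when [x = 0], which is not [r]-related even to
   itself. *)
pose comp x : set X := clos_refl_sym_trans X r x.
have compA x : A x -> comp x `<=` A.
  move=> Ax y /(clos_rst_rstn1 _ _ _ _) xy.
  by case: xy => // {}y z [[]|[]].
have comp_eq x y : comp x y -> comp x = comp y.
  move=> xy; apply/seteqP; split=> z.
    by move=> xz; apply: rst_trans xz; exact: rst_sym.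
  by move=> yz; apply: rst_trans yz.
have comp_countable x : A x -> countable (comp x).
  (* The component is covered by the sets of vectors reached from [x] in exactly [n] edges, each
     countable. *)
  move=> Ax; pose step (B : set X) := \bigcup_(y in B) [set z | r y z].
  have step_countable n : countable (iter n step [set x]).
    elim: n => [|n IH] /=; first exact: countable1.
    apply: bigcup_countable => // y _; have [Ay|nAy] := pselect (A y).
      apply: sub_countable (Ac y Ay); apply: subset_card_le => z [_ Az yz].
      by split.
    by apply: sub_countable (countable0 X); apply: subset_card_le => z [].
  apply: sub_countable (bigcup_countable (countableP [set: nat])
    (fun n _ => step_countable n)).
  apply: subset_card_le => y /(clos_rst_rstn1 _ _ _ _).
  elim=> [|{}y z yz _ [n _ yn]]; first by exists 0%N.
  by exists n.+1 => //=; exists y => //=; case: yz => // /rC.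
have comp_orth x y : A x -> A y -> comp x <> comp y ->
    forall u v, comp x u -> comp y v -> inner X u v = 0.
  move=> Ax Ay xy u v xu yv; apply: contrapT => uv; apply: xy.
  rewrite (comp_eq _ _ xu) (comp_eq _ _ yv); apply/comp_eq/rst_step.
  by split; [exact: compA xu | exact: compA yv |].
(* The choice is indexed by the component as a set, so that all vectors of one component share the
   same orthonormal set. *)
have /choice[F FP] (C : set X) : exists E : set X, countable C ->
    orthonormal_set E /\ E `<=` linear_span C /\ C `<=` linear_span E.
  have [/countable_orthonormalization[E EP]|nC] := pselect (countable C).
    by exists E.
  by exists set0.
exists (\bigcup_(x in A) F (comp x)); split; first split.
- by move=> e [x /comp_countable/FP[[e1 _] _]]; exact: e1.
- move=> e e' [x Ax xe] [y Ay ye'] ee'.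
  have [[_ e_orth] [xspan _]] := FP _ (comp_countable x Ax).
  have [_ [yspan _]] := FP _ (comp_countable y Ay).
  have [xy|xy] := pselect (comp x = comp y).
    by apply: e_orth => //; rewrite xy.
  exact: (span_orthogonal (comp_orth _ _ Ax Ay xy) (xspan _ xe) (yspan _ ye')).
- move=> x Ax; have [_ [_ xspan]] := FP _ (comp_countable x Ax).
  apply: subset_linear_span (xspan x (rst_refl _ _ _)) => e xe.
  by exists x.
Qed.

End Inner.

(** Here [i] is both a section and the adjoint of [p], hence preserves inner products, and [p] is in
    effect the orthogonal projection onto its image. This form serves both coordinate
    projections. *)
Lemma coisometry_orthonormal_basis (R : realType) (k : scalar_kind)
    (X Y : preHilbert R k) (p : {linear X -> Y}) (i : Y -> X) :
  cancel i p -> (forall x y, inner Y (p x) y = inner X x (i y)) ->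
  (exists B : set X, orthonormal_basis B) ->
  exists B : set Y, orthonormal_basis B.
Proof.
move=> ipK adj [B [Bo Bd]].
(* Pythagoras: the squared norms of [x] and [p x] differ by that of [x - i (p x)]. *)
have p_contr x : hnorm (p x) <= hnorm x.
  apply: ler_hnorm; rewrite -subr_ge0.
  suff -> : inner X x x - inner Y (p x) (p x) =
      inner X (x - i (p x)) (x - i (p x)) by exact: inner_ge0.
  rewrite linearBl !linearBr /= (innerC (i _) x) -!adj -innerC ipK.
  by rewrite subrr subr0.
have [|E [Eo Espan]] := @locally_countable_orthonormalization _ _ _ (p @` B).
  move=> _ [b Bb <-].
  have := orthonormal_inner_countable (i (p b)) Bo Bd; apply: sub_countable.
  apply: card_le_trans (card_image_le p _); apply: subset_card_le.
  move=> _ [[b' Bb' <-] bb']; exists b' => //; split=> // /inner_eq0C.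
  by rewrite -adj => /inner_eq0C.
(* Approximate the lift [i y] in [X], then push the approximation down by the contraction [p]. *)
exists E; split=> // y e e0; have [x Bx xe] := Bd (i y) e e0.
exists (p x); first exact: linear_span_sub (linear_span_image p Bx).
by rewrite -(ipK y) -linearB (le_lt_trans (p_contr _)).
Qed.

Lemma dsum_orthonormal_basis (R : realType) (k : scalar_kind)
    (X0 X1 : preHilbert R k) (B0 : set X0) (B1 : set X1) :
  orthonormal_basis B0 -> orthonormal_basis B1 ->
  exists B : set (dsum X0 X1), orthonormal_basis B.
Proof.
move=> [[B01 B0o] B0d] [[B11 B1o] B1d].
pose B : set (dsum X0 X1) :=
  [set u | (B0 u.1 /\ u.2 = 0) \/ (u.1 = 0 /\ B1 u.2)].
have innerE (u v : dsum X0 X1) :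
    inner _ u v = inner X0 u.1 v.1 + inner X1 u.2 v.2 by [].
have B0_span x : linear_span B0 x -> linear_span B (x, 0).
  apply: (@linear_span_ind _ _ _ _ (fun x => linear_span B (x, 0))).
  - exact: (@linear_span0 _ _ (dsum X0 X1)).
  - move=> a y z By Bz; have := linear_spanP a By Bz.
    by congr linear_span; congr pair; rewrite /= scaler0 addr0.
  - by move=> y By; apply: sub_linear_span; left.
have B1_span x : linear_span B1 x -> linear_span B (0, x).
  apply: (@linear_span_ind _ _ _ _ (fun x => linear_span B (0, x))).
  - exact: (@linear_span0 _ _ (dsum X0 X1)).
  - move=> a y z By Bz; have := linear_spanP a By Bz.
    by congr linear_span; congr pair; rewrite /= scaler0 addr0.
  - by move=> y By; apply: sub_linear_span; right.
exists B; split; first split.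
- move=> [x y] [] [/= ]; rewrite innerE /=.
    by move=> /B01 -> ->; rewrite linear0l addr0.
  by move=> -> /B11 ->; rewrite linear0l add0r.
- move=> [x y] [x' y'] [] [/= + +] [] [/= + +]; rewrite innerE /=.
  + move=> Bx -> Bx' -> xx'; rewrite linear0l addr0 B0o// => xx.
    by apply: xx'; rewrite xx.
  + by move=> _ -> -> _ _; rewrite linear0l linear0r addr0.
  + by move=> -> _ _ -> _; rewrite linear0l linear0r addr0.
  + move=> -> By -> By' yy'; rewrite linear0l add0r B1o// => yy.
    by apply: yy'; rewrite yy.
move=> [x y] e e0; have e2 : 0 < e / 2%:R by rewrite divr_gt0.
have [x' Bx' xx'] := B0d x _ e2; have [y' By' yy'] := B1d y _ e2.
exists (x', y').
  have := linear_spanD (B0_span _ Bx') (B1_span _ By').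
  by congr linear_span; congr pair; rewrite /= ?addr0 ?add0r.
rewrite (splitr e); apply: le_lt_trans (ltrD xx' yy').
(* After squaring, the right side exceeds the left by twice the product of the two component
   norms. *)
rewrite -ler_sqr ?nnegrE ?addr_ge0 ?sqrtr_ge0//.
rewrite sqr_hnorm innerE /= reKD -!sqr_hnorm sqrrD lerD2r lerDl.
by rewrite mulrn_wge0// mulr_ge0 ?sqrtr_ge0.
Qed.

Theorem theorem5p1 (R : realType) (k : scalar_kind) (X0 X1 : preHilbert R k) :
  pathological (dsum X0 X1) <-> pathological X0 \/ pathological X1.
Proof.
split=> [Xp|].
  apply: contrapT => /not_orP[/contrapT[B0 B0P] /contrapT[B1 B1P]].
  by apply: Xp; exact: dsum_orthonormal_basis B0P B1P.
case=> Xp XB; apply: Xp; move: XB.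
- apply: (@coisometry_orthonormal_basis _ _ (dsum X0 X1) X0 fst (fun x => (x, 0))) => // x y.
  by rewrite /= /dsum_inner /= linear0r addr0.
- apply: (@coisometry_orthonormal_basis _ _ (dsum X0 X1) X1 snd (fun x => (0, x))) => // x y.
  by rewrite /= /dsum_inner /= linear0r add0r.
Qed.
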